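(* Fix an integer $s\ge0$. As formal power series, $$\sum_{k=1}^{\infty} d_s(k)z^k \;=\; z+\frac{z^2}{1-z^2}\sum_{i=1}^{\infty} z^{si+2^i-1}\bigl(1-z^{2^i}\bigr).$$
   Context: Fix an integer $s\ge 0$. Let $\mathcal{T}_s$ be the following infinite graph. It has super-nodes (level 0 nodes) $s_1,s_2,s_3,\dots$, with $s_{i+1}$ adjacent to $s_i$ for each $i\ge1$. Each super-node $s_i$ has $2^{i-1}$ children (level 1 nodes), called in left-to-right order the 1st, 2nd, $\dots$, $2^{i-1}$th child of $s_i$. Each level 1 node has exactly one child, a level 2 node, and level 2 nodes have no children. In addition there is one isolated node $I$. The leaves of $\mathcal{T}_s$ are the level 2 nodes together with $I$. Nodes are labelled by positive integers as follows: $I$ gets label $1$; then for $i=1,2,3,\dots$ in turn, the super-node $s_i$ receives the next $s$ consecutive unused labels (no label at all if $s=0$), and then for $r=1,2,\dots,2^{i-1}$ in turn, the $r$th child of $s_i$ receives the next unused label and then its child (a leaf) receives the next unused label. Thus each positive integer labels exactly one node. For $n\ge1$ let $v_s(n)$ be the node with label $n$, and let $d_s(n)=1$ if $v_s(n)$ is a leaf and $d_s(n)=0$ otherwise. *)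

(* Defs.v *)
From HB Require Import structures.
From mathcomp Require Import all_boot all_order all_algebra.
From mathcomp Require Import boolp classical_sets functions cardinality fsbigop.

Set Implicit Arguments.
Unset Strict Implicit.
Unset Printing Implicit Defensive.

Import Order.TTheory GRing.Theory.

(* Super k is the super-node s_{k+1}, and for r < 2 ^ k, Child k r is its
   (r+1)th child and Leaf k r is the only child of Child k r. *)
Inductive node : Type :=
| Isolated
| Super of nat
| Child (k : nat) of 'I_(2 ^ k)
| Leaf (k : nat) of 'I_(2 ^ k).

HB.instance Definition _ := gen_eqMixin node.

Definition children (x : node) : seq node :=
  match x with
  | Super k => [seq Child r | r <- enum 'I_(2 ^ k)]
  | Child k r => [:: Leaf r]
  | Isolated | Leaf _ _ => [::]
  end.

Definition level (x : node) : option nat :=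
  match x with
  | Isolated => None
  | Super _ => Some 0
  | Child _ _ => Some 1
  | Leaf _ _ => Some 2
  end.

Definition arc : rel node := fun x y =>
  (if (x, y) is (Super i, Super j) then j == i.+1 else false) ||
  (y \in children x).

Definition adjacent : rel node := fun x y => arc x y || arc y x.

Definition is_leaf : pred node :=
  fun x => (level x == Some 2) || (x == Isolated).

Section Labelling.

Variable s : nat.

(* Nodes are listed in the order of their labels, each as many times as it has
   labels: the entry at (0-based) position n - 1 is the node with label n. *)
Definition block (k : nat) : seq node :=
  nseq s (Super k) ++
  flatten [seq c :: children c | c <- children (Super k)].

Definition listing (K : nat) : seq node :=
  Isolated :: flatten [seq block k | k <- iota 0 K].

(* The first n blocks already use the labels 1, ..., n (see size_listing), so
   the default value of nth is irrelevant for n > 0. *)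
Definition labelled_node (n : nat) : node := nth Isolated (listing n) n.-1.

Definition leaf_indicator (n : nat) : nat := is_leaf (labelled_node n).

Lemma size_block k : size (block k) = s + 2 ^ k.+1.
Proof.
rewrite size_cat size_nseq size_flatten /shape -2!map_comp; congr (_ + _)%N.
rewrite expnSr -(congr1 (muln^~ 2) (size_enum_ord (2 ^ k))).
by elim: (enum _) => //= r rs ->; rewrite mulSn.
Qed.

Lemma size_listing K : K < size (listing K).
Proof.
rewrite /= ltnS; elim: K => // K IH.
rewrite -(addn1 K) iotaD map_cat flatten_cat size_cat /= cats0 leq_add //.
by rewrite size_block addn_gt0 expn_gt0 orbT.
Qed.

Lemma labelled_nodeE K n : n.-1 < size (listing K) ->
  labelled_node n = nth Isolated (listing K) n.-1.
Proof.
have listingD L p : listing (L + p) =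
    listing L ++ flatten [seq block k | k <- iota L p].
  by rewrite /listing iotaD map_cat flatten_cat.
move=> lt_n; have lt_n' : n.-1 < size (listing n).
  exact: leq_ltn_trans (leq_pred n) (size_listing n).
rewrite /labelled_node; move: n.-1 lt_n lt_n' => p lt_n lt_n'.
case: (leqP n K) => [/subnKC | /ltnW/subnKC] <-;
  by rewrite listingD nth_cat ?lt_n' ?lt_n.
Qed.

End Labelling.

Local Open Scope ring_scope.

Record fps (R : Type) : Type := Fps { fcoef : nat -> R }.

Lemma fpsP (R : Type) (f g : fps R) : (forall n, fcoef f n = fcoef g n) -> f = g.
Proof. by case: f g => [f] [g] /= /funext ->. Qed.

HB.instance Definition _ (R : Type) := gen_eqMixin (fps R).
HB.instance Definition _ (R : Type) := gen_choiceMixin (fps R).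

Section Ring.

Variable R : comNzRingType.
Implicit Types f g h : fps R.

Definition fps_zero : fps R := Fps (fun=> 0).
Definition fps_opp f : fps R := Fps (fun n => - fcoef f n).
Definition fps_add f g : fps R := Fps (fun n => fcoef f n + fcoef g n).

Fact fps_addA : associative fps_add.
Proof. by move=> f g h; apply: fpsP => n /=; rewrite addrA. Qed.
Fact fps_addC : commutative fps_add.
Proof. by move=> f g; apply: fpsP => n /=; rewrite addrC. Qed.
Fact fps_add0 : left_id fps_zero fps_add.
Proof. by move=> f; apply: fpsP => n /=; rewrite add0r. Qed.
Fact fps_addN : left_inverse fps_zero fps_opp fps_add.
Proof. by move=> f; apply: fpsP => n /=; rewrite addNr. Qed.

HB.instance Definition _ :=
  GRing.isZmodule.Build (fps R) fps_addA fps_addC fps_add0 fps_addN.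

Definition fps_one : fps R := Fps (fun n => (n == 0%N)%:R).
Definition fps_mul f g : fps R :=
  Fps (fun n => \sum_(i < n.+1) fcoef f i * fcoef g (n - i)).

Let trunc n f : {poly R} := \poly_(i < n.+1) fcoef f i.

Let coef_trunc n f i : (i <= n)%N -> (trunc n f)`_i = fcoef f i.
Proof. by move=> le_in; rewrite coef_poly ltnS le_in. Qed.

Let coef_mul_trunc m n f g : (m <= n)%N ->
  fcoef (fps_mul f g) m = (trunc n f * trunc n g)`_m.
Proof.
move=> le_mn; rewrite coefM; apply: eq_bigr => i _.
have le_im : (i <= m)%N by rewrite -ltnS.
by rewrite !coef_trunc ?(leq_trans _ le_mn) // leq_subr.
Qed.

Fact fps_mulA : associative fps_mul.
Proof.
move=> f g h; apply: fpsP => n.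
transitivity ((trunc n f * trunc n g * trunc n h)`_n); last first.
  rewrite coefM; apply: eq_bigr => i _.
  by rewrite (@coef_mul_trunc _ n) -1?ltnS // coef_trunc ?leq_subr.
rewrite -mulrA coefM; apply: eq_bigr => i _.
by rewrite (@coef_mul_trunc _ n) ?leq_subr // coef_trunc -1?ltnS.
Qed.

Fact fps_mulC : commutative fps_mul.
Proof. by move=> f g; apply: fpsP => n; rewrite !(@coef_mul_trunc _ n) 1?mulrC. Qed.

Fact fps_mul1 : left_id fps_one fps_mul.
Proof.
move=> f; apply: fpsP => n; rewrite /= big_ord_recl /= mul1r subn0.
by rewrite big1 ?addr0 // => i _; rewrite mul0r.
Qed.

Fact fps_mulDl : left_distributive fps_mul fps_add.
Proof.
move=> f g h; apply: fpsP => n /=.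
by rewrite -big_split; apply: eq_bigr => i _; rewrite mulrDl.
Qed.

Fact fps_one_neq0 : fps_one != fps_zero.
Proof.
apply/eqP => /(congr1 (fun f => fcoef f 0)) /= /eqP.
by rewrite oner_eq0.
Qed.

HB.instance Definition _ := GRing.Zmodule_isComNzRing.Build (fps R)
  fps_mulA fps_mulC fps_mul1 fps_mulDl fps_one_neq0.

Definition fps_unit : {pred fps R} := [pred f : fps R | `[< exists g, g * f = 1 >]].

Definition fps_inv f : fps R :=
  if pselect (exists g, g * f = 1) is left ex_g then projT1 (cid ex_g) else f.

Fact fps_mulVf : {in fps_unit, left_inverse 1 fps_inv *%R}.
Proof.
move=> f /asboolP ex_g; rewrite /fps_inv; case: pselect => // ex_g'.
by case: cid.
Qed.

Fact fps_unitPl f g : g * f = 1 -> fps_unit f.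
Proof. by move=> gf1; apply/asboolP; exists g. Qed.

Fact fps_inv_out : {in [predC fps_unit], fps_inv =1 id}.
Proof.
move=> f; rewrite inE /= => /asboolPn nf; rewrite /fps_inv.
by case: pselect.
Qed.

HB.instance Definition _ := GRing.ComNzRing_hasMulInverse.Build (fps R)
  fps_mulVf fps_unitPl fps_inv_out.

Definition fpsX : fps R := Fps (fun n => (n == 1%N)%:R).

(* Infinite sum of a locally finite family: for each n only finitely many terms
   have a nonzero nth coefficient. Outside of this case, a finitely supported
   sum \sum_(i \in A) with infinite support is 0 by convention. *)
Definition fps_summable (A : set nat) (F : nat -> fps R) : Prop :=
  forall n, finite_set [set i | A i /\ fcoef (F i) n <> 0]%classic.

Definition fps_sum (A : set nat) (F : nat -> fps R) : fps R :=
  Fps (fun n => \sum_(i \in A) fcoef (F i) n).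

Lemma fcoefD f g n : fcoef (f + g) n = fcoef f n + fcoef g n.
Proof. by []. Qed.

Lemma fcoefN f n : fcoef (- f) n = - fcoef f n.
Proof. by []. Qed.

Lemma fcoefM f g n :
  fcoef (f * g) n = \sum_(i < n.+1) fcoef f i * fcoef g (n - i).
Proof. by []. Qed.

Lemma fcoef1 n : fcoef (1 : fps R) n = (n == 0%N)%:R.
Proof. by []. Qed.

Lemma fcoefXnM k f n :
  fcoef (fpsX ^+ k * f) n = if (n < k)%N then 0 else fcoef f (n - k).
Proof.
elim: k n => [|k IH] n; first by rewrite mul1r subn0.
rewrite exprS -mulrA fcoefM; case: n => [|n].
  by rewrite big_ord1 mul0r.
rewrite 2!big_ord_recl mul0r add0r mul1r big1 ?addr0 => [|i _].
  by rewrite [(n.+1 - _)%N]subSS subn0 IH subSS ltnS.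
by rewrite mul0r.
Qed.

Lemma fcoefXn k n : fcoef (fpsX ^+ k) n = (n == k)%:R.
Proof.
rewrite -[_ ^+ k]mulr1 fcoefXnM fcoef1 subn_eq0.
by case: ltngtP.
Qed.

Lemma unit_subX k : (0 < k)%N -> 1 - fpsX ^+ k \is a GRing.unit.
Proof.
move=> k_gt0; pose g : fps R := Fps (fun n => (k %| n)%:R).
apply/unitrPr; exists g; rewrite mulrBl mul1r; apply: fpsP => n.
rewrite fcoefD fcoefN fcoefXnM fcoef1 /=; case: ltnP => [lt_nk | le_kn].
  rewrite subr0; case: posnP => [->|n_gt0]; first by rewrite dvdn0.
  by rewrite gtnNdvd.
by rewrite dvdn_subl // subrr gtn_eqF // (leq_trans k_gt0).
Qed.

Lemma fps_summable_mono (A : set nat) (F : nat -> fps R) :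
  (forall i n, A i -> (n < i)%N -> fcoef (F i) n = 0) -> fps_summable A F.
Proof.
move=> F0 n; apply: (@sub_finite_set _ _ `I_n.+1); last exact: finite_II.
move=> i /= [Ai Fin]; rewrite ltnS leqNgt; apply/negP => /(F0 _ _ Ai).
exact: Fin.
Qed.

End Ring.

Arguments fpsX {R}.

Notation "''z'" := fpsX (at level 0) : ring_scope.

(* Both families summed in the main statement are locally finite, and 1 - z ^ 2
   is a unit by unit_subX. *)
Lemma indicator_summable (s : nat) : fps_summable [set k | (1 <= k)%N]%classic
  (fun k => (leaf_indicator s k)%:R * 'z ^+ k : fps int).
Proof.
apply: fps_summable_mono => i n _ lt_ni.
by rewrite mulrC fcoefXnM lt_ni.
Qed.

Lemma level_summable (s : nat) : fps_summable [set i | (1 <= i)%N]%classic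
  (fun i => 'z ^+ (s * i + 2 ^ i - 1) * (1 - 'z ^+ (2 ^ i)) : fps int).
Proof.
apply: fps_summable_mono => i n _ lt_ni; rewrite fcoefXnM ifT //.
apply: leq_trans lt_ni _; rewrite -addnBA ?expn_gt0 //.
by rewrite (leq_trans _ (leq_addl _ _)) // subn1 -ltnS prednK ?expn_gt0 // ltn_expl.
Qed.

(* Main.v *)
(** Cut off at the first K blocks of labels, the generating function of the
    leaves is a polynomial that can be computed one block at a time: the block
    of s_i is preceded by s (i - 1) + 2 ^ i - 1 labels, and its leaves
    contribute z ^ (s + 2) (1 + z ^ 2 + ... + z ^ (2 ^ i - 2)), a geometric sum
    with ratio z ^ 2. Each coefficient of either side only depends on finitely
    many blocks. *)

Require Import Defs.
From mathcomp Require Import all_boot all_order all_algebra.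
From mathcomp Require Import boolp classical_sets fsbigop.
From mathcomp Require Import zify ring.

Import GRing.Theory.

Local Open Scope ring_scope.

Section TruncatedSum.

Variable R : comNzRingType.

Lemma fcoef_sum (r : seq nat) (F : nat -> fps R) n :
  fcoef (\sum_(i <- r) F i) n = \sum_(i <- r) fcoef (F i) n.
Proof.
by elim: r => [|i r IH]; rewrite ?big_nil // !big_cons fcoefD IH.
Qed.

(** Terms of index above [K] start beyond degree [n], so only the first [K] terms matter. *)
Lemma fcoef_fps_sum (F : nat -> fps R) K n : (n <= K)%N ->
    (forall i m, (1 <= i)%N -> (m < i)%N -> fcoef (F i) m = 0) ->
  fcoef (fps_sum [set i | (1 <= i)%N]%classic F) n
  = fcoef (\sum_(0 <= i < K) F i.+1) n.
Proof.
move=> le_nK F0; rewrite -(big_add1 _ _ 0 K.+1 xpredT F) fcoef_sum /=.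
rewrite (fsbigE (index_iota 1 K.+1)) ?iota_uniq //.
- rewrite big_seq_cond [RHS]big_seq; apply: eq_bigl => i.
  rewrite mem_index_iota andbC; case: (boolP (0 < i < _)%N) => [/andP[i1 _]|_].
    by rewrite andbT; apply/mem_set.
  by rewrite andbF.
- by move=> i /=; rewrite mem_index_iota => /andP[].
- move=> i /= i1; rewrite mem_index_iota i1 /= ltnS -ltnNge => lt_Ki.
  by apply: F0 => //; apply: leq_ltn_trans lt_Ki.
Qed.

Lemma fcoefM_congr (h f g : fps R) n :
    (forall m, (m <= n)%N -> fcoef f m = fcoef g m) ->
  fcoef (h * f) n = fcoef (h * g) n.
Proof.
by move=> fg; rewrite !fcoefM; apply: eq_bigr => i _; rewrite fg ?leq_subr.
Qed.

End TruncatedSum.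

(* The classical equality on [node] does not compute, hence neither does
   [is_leaf]. *)
Lemma is_leafE x :
  is_leaf x = if x is (Isolated | Leaf _ _) then true else false.
Proof. by case: x => *; rewrite /is_leaf /= ?eqxx //; apply/eqP. Qed.

(** Horner form: position [n], counted from 0, carries the weight ['z ^+ n]. Labels start at 1,
    hence the extra factor ['z] below. *)
Definition leaf_gf (l : seq node) : fps int :=
  foldr (fun x f => (is_leaf x)%:R + 'z * f) 0 l.

(** The default [Isolated] is itself a leaf, so the test [n < size l] is what makes the coefficients
    past the end vanish. *)
Lemma fcoef_leaf_gf l n :
  fcoef (leaf_gf l) n = ((n < size l)%N && is_leaf (nth Isolated l n))%:R.
Proof.
have coef_nat (b : bool) m : fcoef (b%:R : fps int) m = (b && (m == 0%N))%:R.
  by case: b.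
elim: l n => [|x l IH] n //; rewrite [leaf_gf _]/=.
rewrite fcoefD coef_nat -['z]expr1 fcoefXnM.
case: n => [|n] /=; first by rewrite andbT addr0.
by rewrite andbF add0r subn1 IH.
Qed.

Lemma leaf_gf_cat l1 l2 :
  leaf_gf (l1 ++ l2) = leaf_gf l1 + 'z ^+ size l1 * leaf_gf l2.
Proof.
elim: l1 => [|x l1 IH] /=; first by rewrite mul1r add0r.
by rewrite IH exprS mulrDr mulrA addrA.
Qed.

Lemma leaf_gf_nseq_Super m k : leaf_gf (nseq m (Super k)) = 0.
Proof. by elim: m => //= m ->; rewrite is_leafE mulr0 addr0. Qed.

Lemma leaf_gf_children k :
  (1 - 'z ^+ 2) *
    leaf_gf (flatten [seq c :: children c | c <- children (Super k)])
  = 'z * (1 - 'z ^+ (2 ^ k.+1)).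
Proof.
(* With the exponent written as twice the length of the enumeration, the identity holds for any list
   of children: each pair adds ['z] and shifts the rest by ['z ^+ 2]. *)
rewrite expnS -(size_enum_ord (2 ^ k)) /= -map_comp.
elim: (enum _) => [|r rs IH] /=; first by rewrite muln0 subrr !mulr0.
rewrite mulnS exprD !is_leafE !mulrDr !mulr0 add0r mulr1.
rewrite mulrCA [_ * ('z * leaf_gf _)]mulrCA IH; ring.
Qed.

Lemma leaf_gf_block s k :
  (1 - 'z ^+ 2) * leaf_gf (block s k) = 'z ^+ s.+1 * (1 - 'z ^+ (2 ^ k.+1)).
Proof.
rewrite leaf_gf_cat leaf_gf_nseq_Super add0r size_nseq mulrCA.
by rewrite leaf_gf_children mulrA -exprSr.
Qed.

Lemma listingS s K : listing s K.+1 = listing s K ++ block s K.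
Proof. by rewrite /listing -addn1 iotaD map_cat flatten_cat /= cats0. Qed.

Lemma size_listingE s K : size (listing s K) = (s * K + 2 ^ K.+1 - 1)%N.
Proof.
elim: K => [|K IH]; first by rewrite muln0.
rewrite listingS size_cat IH size_block mulnS (expnS 2 K.+1).
have := expn_gt0 2 K.+1; lia.
Qed.

Lemma leaf_gf_listing s K :
  (1 - 'z ^+ 2) * ('z * leaf_gf (listing s K)) =
  (1 - 'z ^+ 2) * 'z + 'z ^+ 2 *
    \sum_(0 <= i < K) 'z ^+ (s * i.+1 + 2 ^ i.+1 - 1) * (1 - 'z ^+ (2 ^ i.+1)).
Proof.
elim: K => [|K IH].
  by rewrite big_nil /= is_leafE !mulr0 !addr0 mulr1.
rewrite big_nat_recr // listingS leaf_gf_cat ['z * _]mulrDr mulrDr.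
rewrite IH [in RHS]mulrDr addrA.
congr (_ + _); rewrite [LHS]mulrCA [X in _ * X]mulrCA leaf_gf_block !mulrA.
rewrite -exprS -!exprD size_listingE; congr ('z ^+ _ * _).
(* Positivity of the power makes the truncated [- 1] a true subtraction. *)
have := expn_gt0 2 K.+1; rewrite mulnS; lia.
Qed.

Theorem theorem3p2 (s : nat) :
  fps_sum [set k | (1 <= k)%N]%classic
    (fun k => (leaf_indicator s k)%:R * 'z ^+ k) =
  'z + 'z ^+ 2 / (1 - 'z ^+ 2) *
    fps_sum [set i | (1 <= i)%N]%classic
      (fun i => 'z ^+ (s * i + 2 ^ i - 1) * (1 - 'z ^+ (2 ^ i))) :> fps int.
Proof.
have unit_z2 : 1 - 'z ^+ 2 \is a @GRing.unit (fps int) by exact: unit_subX.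
apply: fpsP => n; rewrite fcoefD.
have level0 i m : (1 <= i)%N -> (m < i)%N ->
    fcoef ('z ^+ (s * i + 2 ^ i - 1) * (1 - 'z ^+ (2 ^ i)) : fps int) m = 0.
  move=> _ lt_mi; rewrite fcoefXnM ifT //.
  have := ltn_expl i (ltnSn 1); lia.
(* Coefficient [n] of a product uses only coefficients up to [n], so the series can be cut at [n]
   terms. *)
rewrite (fcoefM_congr _ _ _ _ _
  (fun m le_mn => fcoef_fps_sum _ _ n _ le_mn level0)).
rewrite -fcoefD.
have -> : 'z + 'z ^+ 2 / (1 - 'z ^+ 2) *
    \sum_(0 <= i < n) 'z ^+ (s * i.+1 + 2 ^ i.+1 - 1) * (1 - 'z ^+ (2 ^ i.+1))
    = 'z * leaf_gf (listing s n).
  apply: (mulrI unit_z2); rewrite leaf_gf_listing mulrDr; congr (_ + _).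
  by rewrite mulrA mulrCA mulrV // mulr1.
rewrite (fcoef_fps_sum _ _ n) // => [|i m _ lt_mi]; last first.
  by rewrite mulrC fcoefXnM lt_mi.
rewrite fcoef_sum -{2}['z]expr1 fcoefXnM.
case: n => [|n]; first by rewrite big_nil.
(* Only the last term reaches degree [n.+1]. Cutting at [n.+1] blocks gives exactly the listing that
   defines [labelled_node s n.+1]. *)
rewrite big_nat_recr // big_nat big1 ?add0r => [|i /andP[_ lt_in]].
  rewrite mulrC fcoefXnM ltnn subnn subn1 fcoef_leaf_gf.
  rewrite (ltn_trans (ltnSn n) (size_listing s n.+1)).
  rewrite /leaf_indicator /labelled_node.
  by case: is_leaf.
rewrite mulrC fcoefXnM ltnNge ltnS (ltnW lt_in) subSS.
rewrite /leaf_indicator; case: is_leaf => //.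
by rewrite fcoef1 subn_eq0 leqNgt lt_in.
Qed.
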